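(* \[\lim_{n\to\infty}\frac{\operatorname{Gut}(P_n)}{\operatorname{Kf}^*(P_n)}=3\quad\text{and}\quad\lim_{n\to\infty}\frac{\operatorname{Gut}(P'_n)}{\operatorname{Kf}^*(P'_n)}=3.\]
   Context: For $n\geq 2$, both graphs have vertex set $\{u_1,\dots,u_{2n}\}\cup\{u'_1,\dots,u'_{2n}\}\cup\{w_1,\dots,w_n\}$. Common edges: $u_ku_{k+1}$ and $u'_ku'_{k+1}$ for $1\le k\le 2n-1$; $u_{2k-1}u'_{2k-1}$ for $1\le k\le n$; $u_{2k}w_k$ and $w_ku'_{2k}$ for $1\le k\le n$. The pentagonal cylinder chain $P_n$ additionally has edges $u_{2n}u_1$ and $u'_{2n}u'_1$; the pentagonal Möbius chain $P'_n$ instead has edges $u_{2n}u'_1$ and $u'_{2n}u_1$. For a connected graph with vertices $v_1,\dots,v_N$, degrees $d_i$, distances $d_{ij}$ and effective resistances $r_{ij}$ (unit resistance per edge): $\operatorname{Gut}(G)=\frac12\sum_{i,j}d_id_jd_{ij}$ and $\operatorname{Kf}^*(G)=\frac12\sum_{i,j}d_id_jr_{ij}$ (equivalently $2|E|\sum_{i\ge2}1/\lambda_i$ over the nonzero eigenvalues $\lambda_i$ of the normalized Laplacian). *)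

(* Defs.v *)
From mathcomp Require Import all_boot all_order all_algebra.
From mathcomp Require Import all_classical all_reals all_analysis.

Set Implicit Arguments.
Unset Strict Implicit.
Unset Printing Implicit Defensive.
Import Order.TTheory GRing.Theory Num.Theory.
Import numFieldNormedType.Exports.
Local Open Scope classical_set_scope.
Local Open Scope ring_scope.

(* A simple graph on a finite type [T] is given by its adjacency relation
   [e], assumed symmetric and irreflexive. *)
Section GraphInvariants.
Variables (T : finType) (e : rel T).

Definition deg (x : T) : nat := #|[pred y | e x y]|.

Definition walk (k : nat) (x y : T) : bool :=
  [exists p : k.-tuple T, path e x p && (last x p == y)].

(* The least length of a walk from [x] to [y]; such a walk, when there is one,
   can be taken of length < #|T|.  Takes the junk value #|T| if [x] and [y] are
   not connected. *)
Definition dist (x y : T) : nat := find (fun k => walk k x y) (iota 0 #|T|).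

Variable R : realType.

(* Kirchhoff's and Ohm's laws with unit resistances: the net current leaving
   each vertex [x] under the potential [v] is that of a unit current entering
   the network at [i] and leaving it at [j]. *)
Definition unit_current (i j : T) (v : T -> R) : Prop :=
  forall x, \sum_(y | e x y) (v x - v y) = (x == i)%:R - (x == j)%:R.

(* The potential difference between [i] and [j] that drives a unit current from
   [i] to [j].  In a connected graph [v] exists and is unique up to an additive
   constant; the default value 0 is used only if no [v] exists. *)
Definition eff_res (i j : T) : R :=
  xget 0 [set r | exists v, unit_current i j v /\ r = v i - v j].

Definition Gut : R :=
  2^-1 * \sum_(i : T) \sum_(j : T) (deg i)%:R * (deg j)%:R * (dist i j)%:R.

Definition Kfstar : R :=
  2^-1 * \sum_(i : T) \sum_(j : T) (deg i)%:R * (deg j)%:R * eff_res i j.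

End GraphInvariants.

Arguments Gut {T} e R.
Arguments Kfstar {T} e R.

(* Indices start at 0: [vu i] is u_(i+1), [vu' i] is u'_(i+1) and [vw k] is
   w_(k+1). *)
Definition vertex (n : nat) : finType := ('I_n.*2 + 'I_n.*2 + 'I_n)%type.

Notation vu i := (inl (inl i)).
Notation vu' i := (inl (inr i)).
Notation vw k := (inr k).

Definition common_arc n (x y : vertex n) : bool :=
  match x, y with
  | vu i, vu j => j == i.+1 :> nat
  | vu' i, vu' j => j == i.+1 :> nat
  | vu i, vu' j => (i == j) && ~~ odd i
  | vu i, vw k => i == k.*2.+1 :> nat
  | vw k, vu' i => i == k.*2.+1 :> nat
  | _, _ => false
  end.

Definition wraps n (i j : 'I_n.*2) : bool := (i.+1 == n.*2) && (j == 0%N :> nat).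

Definition cylinder_arc n (x y : vertex n) : bool :=
  match x, y with
  | vu i, vu j => wraps i j
  | vu' i, vu' j => wraps i j
  | _, _ => false
  end.

Definition moebius_arc n (x y : vertex n) : bool :=
  match x, y with
  | vu i, vu' j => wraps i j
  | vu' i, vu j => wraps i j
  | _, _ => false
  end.

Definition pent_cylinder n : rel (vertex n) := fun x y =>
  [|| common_arc x y, common_arc y x, cylinder_arc x y | cylinder_arc y x].

Definition pent_moebius n : rel (vertex n) := fun x y =>
  [|| common_arc x y, common_arc y x, moebius_arc x y | moebius_arc y x].

Arguments pent_cylinder n : clear implicits.
Arguments pent_moebius n : clear implicits.

(* Main.v *)
(* Record the position of a vertex on the cycle Z/2n (w_k has the position of
   u_2k and u'_2k).  Graph distance agrees with cyclic distance up to a bounded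
   error.  For the resistances, pairing a potential v driving a unit current
   with the Green function phi(|. - p|) of the cycle, phi t = t (2n - t), computes
   the rim averages of v exactly, while the part of v that is antisymmetric under
   exchanging the two rims is bounded by the maximum principle, because every
   vertex is adjacent either to its mirror image or to a fixed vertex.  Hence
   r = phi(t) / 4n + O(1) at cyclic distance t.  Every position carries degree
   7 on average, so both indices are asymptotic to 98 n times a one-variable
   sum: Gut = 49 n^3 + O(n^2) and Kf* = (49/3) n^3 + O(n^2). *)
Require Import Defs.
From mathcomp Require Import all_boot all_order all_algebra.
From mathcomp Require Import all_classical all_reals all_analysis.
From mathcomp Require Import zify ring lra.
Import Order.TTheory GRing.Theory Num.Theory.
Import numFieldNormedType.Exports.
Local Open Scope classical_set_scope.
Local Open Scope ring_scope.

Set Implicit Arguments.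
Unset Strict Implicit.
Unset Printing Implicit Defensive.

(** * Walks and potentials in a finite graph *)

Section Walks.
Variables (T : finType) (e : rel T).

Lemma walkP k x y :
  reflect (exists2 p : seq T, path e x p & last x p = y /\ size p = k)
          (walk e k x y).
Proof.
apply: (iffP existsP) => [[p /andP[ep /eqP py]]|[p ep [py /eqP kp]]].
  by exists p => //; rewrite size_tuple.
by exists (Tuple kp); rewrite /= ep py eqxx.
Qed.

Lemma walk0 x : walk e 0 x x.
Proof. by apply/walkP; exists [::]. Qed.

Lemma walk1 x y : e x y -> walk e 1 x y.
Proof. by move=> exy; apply/walkP; exists [:: y] => //=; rewrite exy. Qed.

Lemma walk_trans k l x y z : walk e k x y -> walk e l y z -> walk e (k + l) x z.
Proof.
move=> /walkP[p ep [py <-]] /walkP[q eq [qz <-]]; apply/walkP; exists (p ++ q).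
  by rewrite cat_path ep py.
by rewrite last_cat py size_cat.
Qed.

Lemma walk_sym k x y : symmetric e -> walk e k x y -> walk e k y x.
Proof.
move=> e_sym /walkP[p + [<- <-]]; elim: p x => [|z p IHp] x /=.
  by move=> _; exact: walk0.
move=> /andP[exz /IHp]; rewrite -addn1 => /walk_trans; apply.
by apply: walk1; rewrite e_sym.
Qed.

(** [find] never exceeds [#|T|], so a [k] below the distance lies in the searched range and would
    have been found; long walks need no shortening. *)
Lemma dist_le_walk k x y : walk e k x y -> (dist e x y <= k)%N.
Proof.
move=> kxy; rewrite leqNgt; apply/negP => lt_k.
have := before_find 0%N lt_k; rewrite nth_iota ?add0n ?kxy //.
by apply: leq_trans lt_k _; rewrite -[leqRHS](size_iota 0) find_size.
Qed.

(** A potential that rises by at most 1 per edge rises by at most the length of any walk. The second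
    hypothesis covers the junk value [#|T|] of [dist] when there is no walk. *)
Lemma dist_lower_bound (phi : T -> nat) x y :
    (forall y z, e y z -> phi z <= (phi y).+1)%N ->
  (phi y <= phi x + #|T|)%N -> (phi y <= phi x + dist e x y)%N.
Proof.
move=> lip phiT; have [hw|] := boolP (has (fun k => walk e k x y) (iota 0 #|T|)).
  have := nth_find 0%N hw; rewrite nth_iota; last first.
    by rewrite -[ltnRHS](size_iota 0) -has_find.
  rewrite add0n -/(dist e x y) => /walkP[p ep [<- <-]].
  elim: p x ep {phiT hw} => [|z p IHp] x /=; first by rewrite addn0.
  move=> /andP[/lip exz /IHp]; lia.
by move=> /hasNfind; rewrite size_iota -/(dist e x y) => ->.
Qed.

End Walks.

(** * Graph Laplacian, unit currents and the maximum principle *)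

Section Laplacian.
Variables (R : realType) (T : finType) (e : rel T).
Hypothesis e_sym : symmetric e.

Definition lap (v : T -> R) x := \sum_(y | e x y) (v x - v y).

(** Self-adjointness: the difference of the two sides sums [v x * g y - v y * g x] over ordered
    edges, and the two orientations cancel. *)
Lemma lap_sym v g : \sum_x lap v x * g x = \sum_x v x * lap g x.
Proof.
apply/eqP; rewrite -subr_eq0 -sumrB; apply/eqP.
rewrite (eq_bigr (fun x => \sum_(y | e x y) (v x * g y - v y * g x))); last first.
  move=> x _; rewrite mulr_suml mulr_sumr -sumrB.
  by apply: eq_bigr => y _; ring.
under eq_bigr do rewrite sumrB.
rewrite sumrB (exchange_big_dep xpredT) //=.
apply/eqP; rewrite subr_eq0; apply/eqP.
by apply: eq_bigr => x _; apply: eq_bigl => y; rewrite e_sym.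
Qed.

Lemma sum_lap v : \sum_x lap v x = 0.
Proof.
have := lap_sym v (fun=> 1); under eq_bigr do rewrite mulr1.
move=> ->; rewrite big1 // => x _.
by rewrite /lap big1 ?mulr0 // => y _; rewrite subrr.
Qed.

Lemma lap_lin v x : lap v x = \sum_z v z * lap (fun y => (y == z)%:R) x.
Proof.
have pick w : \sum_z v z * (w == z)%:R = v w.
  rewrite (bigD1 w) //= eqxx mulr1 big1 ?addr0 // => z.
  by rewrite eq_sym => /negPf ->; rewrite mulr0.
under eq_bigr do rewrite mulr_sumr.
rewrite exchange_big; apply: eq_bigr => y _ /=.
by under eq_bigr do rewrite mulrBr; rewrite sumrB !pick.
Qed.

(* The rank-one perturbation [lap + (sum of all values)] is injective, hence
   onto, and agrees with [lap] wherever its value sums to 0. *)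
Lemma unit_current_exists i j :
    (forall h, (forall x, lap h x = 0) -> forall x y, h x = h y) ->
  exists v : T -> R, unit_current e i j v.
Proof.
move=> ker.
pose M := \matrix_(a < #|T|, b < #|T|)
  (lap (fun y => (y == enum_val a)%:R) (enum_val b) + 1).
pose fn (u : 'rV[R]_#|T|) x := u 0 (enum_rank x).
have uM u x : (u *m M) 0 (enum_rank x) = lap (fn u) x + \sum_z fn u z.
  rewrite mxE lap_lin -big_split (reindex_onto enum_rank enum_val) => [|a _];
    last exact: enum_valK.
  rewrite /=; apply: eq_big => [z|z _]; first by rewrite enum_rankK eqxx.
  by rewrite mxE !enum_rankK mulrDr mulr1.
have cardT : (#|T|%:R : R) != 0.
  by rewrite pnatr_eq0 -lt0n; apply/card_gt0P; exists i.
(* Values of [lap] sum to 0, so summing the image leaves only the perturbation, counted once per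
   vertex. *)
have sum_fn u : \sum_x (u *m M) 0 (enum_rank x) = #|T|%:R * \sum_z fn u z.
  under eq_bigr do rewrite uM.
  by rewrite big_split /= sum_lap add0r sumr_const mulr_natl.
have Mfree : row_free M.
  apply: inj_row_free => u uM0.
  have sum0 : \sum_z fn u z = 0.
    apply: (mulfI cardT); rewrite -sum_fn mulr0 big1 // => x _.
    by rewrite uM0 mxE.
  have const : forall x y, fn u x = fn u y.
    by apply: ker => x; have := uM u x; rewrite uM0 mxE sum0 addr0.
  apply/rowP => a; rewrite mxE -(enum_valK a) -/(fn u (enum_val a)).
  apply: (mulfI cardT); rewrite mulr0 -sum0.
  by rewrite (eq_bigr (fun=> fn u (enum_val a))) // sumr_const mulr_natl.
(* The right-hand side sums to 0; by [sum_fn] its preimage does too, and the perturbation vanishes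
   on it. *)
pose b := \row_(a < #|T|) ((enum_val a == i)%:R - (enum_val a == j)%:R : R).
have ub : b *m invmx M *m M = b by rewrite mulmxKV // -row_free_unit.
exists (fn (b *m invmx M)) => x.
have := uM (b *m invmx M) x; rewrite ub mxE enum_rankK => ->.
have := sum_fn (b *m invmx M); rewrite ub.
under eq_bigr do rewrite mxE enum_rankK.
rewrite sumrB (bigD1 i) //= eqxx big1 => [|z /negPf -> //].
rewrite (bigD1 j) //= eqxx big1 => [|z /negPf -> //].
rewrite subrr => /esym/eqP; rewrite mulf_eq0 (negPf cardT) /= => /eqP ->.
by rewrite addr0.
Qed.

Lemma eff_resP i j : (exists v : T -> R, unit_current e i j v) ->
  exists2 v : T -> R, unit_current e i j v & eff_res e R i j = v i - v j.
Proof.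
move=> [v vij]; rewrite /eff_res.
case: xgetP => [r _ [w [wij ->]]|/(_ (v i - v j)) []]; first by exists w.
by exists v.
Qed.

(* Maximum principle for the antisymmetric part [v - v \o s]. *)
Lemma antisym_part_le (s : T -> T) (v : T -> R) (M : R) :
    (forall x y, e (s x) (s y) = e x y) -> involutive s ->
    (forall x, s x = x \/ exists2 y, e x y & s y = y \/ y = s x) ->
    0 <= M -> (forall x, `|lap v x| <= M) ->
  forall x, v x - v (s x) <= 2 * M.
Proof.
move=> s_aut sK near M0 lapM x0.
pose d x := v x - v (s x).
have lap_d x : lap d x = lap v x - lap v (s x).
  rewrite /lap [X in _ - X](reindex_inj (inv_inj sK)) /=.
  rewrite (eq_bigl _ _ (s_aut x)) -sumrB.
  by apply: eq_bigr => y _; rewrite /d; ring.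
case: (@Order.TotalTheory.arg_maxP _ _ _ x0 xpredT d isT) => x _ x_max.
apply: le_trans (x_max x0 isT) _.
have [sx|[y exy sy]] := near x; first by rewrite /d sx subrr mulr_ge0.
have [dx0|dx0] := leP (d x) 0; first by apply: le_trans dx0 _; rewrite mulr_ge0.
(* At a fixed vertex [d] is 0, and at the mirror image of [x] it is [- d x]. *)
have dy : d y <= 0.
  case: sy => [sy|->]; first by rewrite /d sy subrr.
  by move: dx0; rewrite /d sK; lra.
(* The edge to [y] alone contributes at least [d x]; the other terms are nonnegative because [d] is
   maximal at [x]. *)
have : d x <= lap d x.
  rewrite /lap (bigD1 y) //= -[leLHS]addr0 lerD //; first lra.
  by apply: sumr_ge0 => z _; rewrite subr_ge0; exact: x_max.
rewrite lap_d; have := lapM x; have := lapM (s x).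
by rewrite !ler_norml => /andP[? ?] /andP[? ?]; lra.
Qed.

End Laplacian.

(** * The pentagonal chains *)

Definition absdiff (p q : nat) : nat := (p - q + (q - p))%N.

Definition cycdist (N p q : nat) : nat := minn (absdiff p q) (N - absdiff p q).

Section Positions.
Variable n : nat.

Definition rim (s : bool) (i : 'I_n.*2) : vertex n :=
  if s then vu' i else vu i.

Lemma odd_ord_subproof (k : 'I_n) : (k.*2.+1 < n.*2)%N.
Proof. by have := ltn_ord k; lia. Qed.
Definition odd_ord k := Ordinal (odd_ord_subproof k).

Lemma half_ord_subproof (i : 'I_n.*2) : (i./2 < n)%N.
Proof. by have := ltn_ord i; lia. Qed.
Definition half_ord i := Ordinal (half_ord_subproof i).

Definition pos (x : vertex n) : nat :=
  match x with vu i | vu' i => i | vw k => k.*2.+1 end.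

Definition swap (x : vertex n) : vertex n :=
  match x with vu i => vu' i | vu' i => vu i | vw k => vw k end.

(** The neighbour of a rim vertex off the cyclic direction. With indices from 0, the vertices
    attached to some [w] are those of odd index. *)
Definition mid s (i : 'I_n.*2) : vertex n :=
  if odd i then vw (half_ord i) else rim (~~ s) i.

Lemma val_ordS (i : 'I_n.*2) :
  ordS i = (if i.+1 == n.*2 then 0 else i.+1) :> nat.
Proof.
rewrite /=; case: eqP => [->|?]; first by rewrite modnn.
by rewrite modn_small //; have := ltn_ord i; lia.
Qed.

Lemma val_ord_pred (i : 'I_n.*2) :
  ord_pred i = (if i == 0 :> nat then n.*2.-1 else i.-1) :> nat.
Proof.
rewrite /=; have := ltn_ord i; case: eqP => [->|? ltin].
  by rewrite add0n => ?; rewrite modn_small //; lia.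
have -> : ((i + n.*2).-1 = i.-1 + n.*2)%N by lia.
by rewrite modnDr modn_small //; lia.
Qed.

Lemma pos_rim s (i : 'I_n.*2) : pos (rim s i) = i. Proof. by case: s. Qed.

Lemma pos_mid s (i : 'I_n.*2) : pos (mid s i) = i.
Proof. by rewrite /mid; case: ifP => oi; rewrite ?pos_rim //=; lia. Qed.

Lemma pos_lt x : (pos x < n.*2)%N.
Proof. by case: x => [[i|i]|k] /=; rewrite ?ltn_ord ?odd_ord_subproof. Qed.

Lemma vertexP (P : vertex n -> Prop) :
  (forall s i, P (rim s i)) -> (forall k, P (vw k)) -> forall x, P x.
Proof. by move=> Pr Pw [[i|i]|k] //; [exact: Pr false i|exact: Pr true i]. Qed.

Lemma swapK : involutive swap. Proof. by case=> [[]|]. Qed.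

Lemma swap_rim s i : swap (rim s i) = rim (~~ s) i. Proof. by case: s. Qed.

Lemma swap_mid s i : swap (mid s i) = mid (~~ s) i.
Proof. by rewrite /mid; case: ifP => // _; rewrite swap_rim. Qed.

Lemma sum_vertex (V : nmodType) (F : vertex n -> V) :
  \sum_x F x = \sum_(i < n.*2) (F (rim false i) + F (rim true i))
               + \sum_(k < n) F (vw k).
Proof. by rewrite !big_sumType /= big_split. Qed.

End Positions.

(* Both chains at once: [tw] tells whether the wrapping edges are crossed. *)
Record pent_chain (n : nat) (tw : bool) (e : rel (vertex n)) : Prop := {
  chain_sym : symmetric e;
  chain_rim : forall s i y, e (rim s i) y =
    (y \in [:: rim (s (+) (tw && (i.+1 == n.*2))) (ordS i);
               rim (s (+) (tw && (i == 0%N :> nat))) (ord_pred i); mid s i]);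
  chain_vw : forall k y, e (vw k) y =
    (y \in [:: rim false (odd_ord k); rim true (odd_ord k)])
}.

Lemma vu_eqE n (i j : 'I_n.*2) :
  ((vu i == vu j :> vertex n) = (i == j :> nat)) *
  ((vu' i == vu' j :> vertex n) = (i == j :> nat)) *
  ((vu i == vu' j :> vertex n) = false) * ((vu' i == vu j :> vertex n) = false).
Proof. by []. Qed.

Lemma vw_eqE n (k l : 'I_n) : (vw k == vw l :> vertex n) = (k == l :> nat).
Proof. by []. Qed.

Lemma vu_vw_eqE n (i : 'I_n.*2) (k : 'I_n) :
  ((vu i == vw k :> vertex n) = false) * ((vu' i == vw k :> vertex n) = false) *
  ((vw k == vu i :> vertex n) = false) * ((vw k == vu' i :> vertex n) = false).
Proof. by []. Qed.

Definition vertex_eqE := (vu_eqE, vw_eqE, vu_vw_eqE).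

Lemma cylinder_chain n : (1 < n)%N -> pent_chain false (pent_cylinder n).
Proof.
move=> n_gt1; split.
- by move=> x y; rewrite /pent_cylinder orbCA; congr [|| _, _ | _]; rewrite orbC.
- move=> s i y; rewrite !inE /pent_cylinder /mid.
  (* The cyclic neighbours become variables known only by their values, so every case is linear
     arithmetic. *)
  move: (ordS i) (ord_pred i) (val_ordS i) (val_ord_pred i) => u d uE dE.
  have := ltn_ord i; case: (boolP (odd i)) => oi; case: s; case: y => [[j|j]|j];
    have := ltn_ord j; rewrite /= /wraps;
    (case: eqP uE => iN uE); (case: eqP dE => i0 dE);
    rewrite /rim /= !vertex_eqE -?val_eqE /= ?uE ?dE; lia.
- move=> k y; rewrite !inE /pent_cylinder.
  by case: y => [[j|j]|j]; rewrite /rim !vertex_eqE /=; have := ltn_ord j; lia.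
Qed.

Lemma moebius_chain n : (1 < n)%N -> pent_chain true (pent_moebius n).
Proof.
move=> n_gt1; split.
- by move=> x y; rewrite /pent_moebius orbCA; congr [|| _, _ | _]; rewrite orbC.
- move=> s i y; rewrite !inE /pent_moebius /mid.
  move: (ordS i) (ord_pred i) (val_ordS i) (val_ord_pred i) => u d uE dE.
  have := ltn_ord i; case: (boolP (odd i)) => oi; case: s; case: y => [[j|j]|j];
    have := ltn_ord j; rewrite /= /wraps;
    (case: eqP uE => iN uE); (case: eqP dE => i0 dE);
    rewrite /rim /= !vertex_eqE -?val_eqE /= ?uE ?dE; lia.
- move=> k y; rewrite !inE /pent_moebius.
  by case: y => [[j|j]|j]; rewrite /rim !vertex_eqE /=; have := ltn_ord j; lia.
Qed.

(** * Degrees, distances and the mirror symmetry of a chain *)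

Section Chain.
Variables (n : nat) (tw : bool) (e : rel (vertex n)).
Hypothesis n_gt1 : (1 < n)%N.
Hypothesis e_chain : pent_chain tw e.

Let e_sym := chain_sym e_chain.
Let next s (i : 'I_n.*2) := rim (s (+) (tw && (i.+1 == n.*2))) (ordS i).
Let prev s (i : 'I_n.*2) :=
  rim (s (+) (tw && (i == 0%N :> nat))) (ord_pred i).

(** Their positions are i+1, i-1 and i modulo 2n, pairwise distinct since 2n > 2, whatever the
    twist. *)
Lemma uniq_rim_nbrs s i : uniq [:: next s i; prev s i; mid s i].
Proof.
apply: (@map_uniq _ _ (@pos n)); rewrite /= !inE !pos_rim pos_mid.
rewrite val_ordS val_ord_pred; have := ltn_ord i.
by case: (i.+1 =P n.*2) => ?; case: (nat_of_ord i =P 0%N) => ?; lia.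
Qed.

Lemma deg_rim s i : deg e (rim s i) = 3%N.
Proof.
by rewrite /deg (eq_card (chain_rim e_chain s i)) (card_uniqP (uniq_rim_nbrs s i)).
Qed.

Lemma deg_vw k : deg e (vw k) = 2%N.
Proof. by rewrite /deg (eq_card (chain_vw e_chain k)) (card_uniqP _). Qed.

Lemma sum_rim_nbrs (V : nmodType) (f : vertex n -> V) s i :
  \sum_(y | e (rim s i) y) f y = f (next s i) + (f (prev s i) + f (mid s i)).
Proof.
rewrite (eq_bigl _ _ (chain_rim e_chain s i)) -big_uniq ?uniq_rim_nbrs //.
by rewrite !big_cons big_nil /= addr0.
Qed.

Lemma sum_vw_nbrs (V : nmodType) (f : vertex n -> V) k :
  \sum_(y | e (vw k) y) f y = f (rim false (odd_ord k)) + f (rim true (odd_ord k)).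
Proof.
rewrite (eq_bigl _ _ (chain_vw e_chain k)) -big_uniq //.
by rewrite !big_cons big_nil /= addr0.
Qed.

Lemma edge_rim_mid s i : e (rim s i) (mid s i).
Proof. by rewrite (chain_rim e_chain) !inE eqxx !orbT. Qed.

Lemma edge_rim_next s i : e (rim s i) (next s i).
Proof. by rewrite (chain_rim e_chain) !inE eqxx. Qed.

Lemma edge_vw s k : e (vw k) (rim s (odd_ord k)).
Proof.
rewrite (chain_vw e_chain) !inE.
by case: s; rewrite eqxx ?orbT.
Qed.

Lemma cycdist_edge p x y : (p < n.*2)%N -> e x y ->
  (cycdist n.*2 p (pos y) <= (cycdist n.*2 p (pos x)).+1)%N.
Proof.
move=> ltp; elim/vertexP: x => [s i|k].
  rewrite (chain_rim e_chain) !inE => /or3P[]/eqP->.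
  - rewrite !pos_rim val_ordS /cycdist /absdiff; have := ltn_ord i.
    by case: eqP; lia.
  - rewrite !pos_rim val_ord_pred /cycdist /absdiff; have := ltn_ord i.
    by case: eqP; lia.
  - by rewrite pos_mid pos_rim.
by rewrite (chain_vw e_chain) !inE => /orP[]/eqP->; rewrite pos_rim.
Qed.

Lemma cycdist_le_dist x y : (cycdist n.*2 (pos x) (pos y) <= dist e x y)%N.
Proof.
have := @dist_lower_bound _ e (fun z => cycdist n.*2 (pos x) (pos z)) x y.
have -> p : cycdist n.*2 p p = 0%N by rewrite /cycdist /absdiff; lia.
rewrite !add0n; apply.
  by move=> z t; apply: cycdist_edge; rewrite pos_lt.
(* The graph has 5n vertices, more than any cyclic distance on 2n positions. *)
by rewrite !card_sum !card_ord /cycdist; lia.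
Qed.

(** The final rim is left open, since a crossed wrapping edge changes it. *)
Lemma walk_forward k s (i : 'I_n.*2) : exists (s' : bool) (j : 'I_n.*2),
  j = ((i + k) %% n.*2)%N :> nat /\ walk e k (rim s i) (rim s' j).
Proof.
elim: k => [|k [s' [j [jE wk]]]].
  exists s, i; split; last exact: walk0.
  by rewrite addn0 modn_small.
exists (s' (+) (tw && (j.+1 == n.*2))), (ordS j); split.
  by rewrite /= jE addnS -addn1 modnDml addn1.
rewrite -addn1; apply: walk_trans wk _; apply: walk1; exact: edge_rim_next.
Qed.

(** Two rim vertices at one position are adjacent if it is even and share a neighbour [w] if it is
    odd. *)
Lemma walk_fiber x y : pos x = pos y ->
  exists2 k, (k <= 2)%N & walk e k x y.
Proof.
have rr s i : exists2 k, (k <= 2)%N & walk e k (rim s i) (rim (~~ s) i).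
  have [oi|ei] := boolP (odd i).
    exists 2%N => //; apply: (@walk_trans _ _ 1 1 _ (mid s i)).
      by apply: walk1; exact: edge_rim_mid.
    apply: walk1; rewrite e_sym; have := edge_rim_mid (~~ s) i.
    by rewrite /mid oi.
  by exists 1%N => //; apply: walk1; have := edge_rim_mid s i; rewrite /mid (negPf ei).
have rw s k : walk e 1 (vw k) (rim s (odd_ord k)) by apply: walk1; exact: edge_vw.
elim/vertexP: x => [s i|k]; elim/vertexP: y => [t j|l]; rewrite ?pos_rim /=.
- move=> /val_inj ->; have [->|st] := eqVneq s t; first by exists 0%N; rewrite ?walk0.
  by have := rr s j; have -> : ~~ s = t by move: st; case: s; case: t.
- move=> iE; exists 1%N => //; apply: walk_sym => //.
  by rewrite (_ : i = odd_ord l); [exact: rw|exact: val_inj].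
- move=> iE; exists 1%N => //.
  by rewrite (_ : j = odd_ord k); [exact: rw|exact/val_inj/esym].
- move=> kl; exists 0%N => //; rewrite (_ : k = l) ?walk0 //.
  by apply: val_inj; move: kl => /=; lia.
Qed.

(** The 4 pays for two moves inside a fibre, of at most 2 steps each: onto a rim at the start and to
    [y] at the end. *)
Lemma dist_le_forward k x y : pos y = ((pos x + k) %% n.*2)%N ->
  exists2 l, (l <= k + 4)%N & walk e l x y.
Proof.
move=> yE.
pose i := Ordinal (pos_lt x).
have [a a2 xa] : exists2 a, (a <= 2)%N & walk e a x (rim false i).
  by apply: walk_fiber; rewrite pos_rim.
have [s [j [jE wk]]] := walk_forward k false i.
have [b b2 yb] : exists2 b, (b <= 2)%N & walk e b (rim s j) y.
  by apply: walk_fiber; rewrite pos_rim yE jE.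
exists (a + k + b)%N; first by lia.
by apply: walk_trans yb; apply: walk_trans xa wk.
Qed.

Lemma dist_le_cycdist x y : (dist e x y <= cycdist n.*2 (pos x) (pos y) + 4)%N.
Proof.
suff [l ll wl] : exists2 l, (l <= cycdist n.*2 (pos x) (pos y) + 4)%N & walk e l x y.
  exact: leq_trans (dist_le_walk wl) ll.
wlog le_xy : x y / (pos x <= pos y)%N => [IH|].
  have [/IH //|/ltnW/IH[l ll wl]] := leqP (pos x) (pos y).
  exists l; last exact: walk_sym.
  by move: ll; rewrite /cycdist /absdiff; lia.
have lty := pos_lt y; rewrite /cycdist /absdiff.
have [d_small|d_large] := leqP (pos y - pos x) (n.*2 - (pos y - pos x)).
  have [l ll wl] : exists2 l, (l <= (pos y - pos x) + 4)%N & walk e l x y.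
    by apply: dist_le_forward; rewrite subnKC // modn_small.
  by exists l => //; lia.
(* The shorter way passes the wrap: walk forward from [y] to [x], then reverse. *)
have [l ll wl] : exists2 l, (l <= (n.*2 - (pos y - pos x)) + 4)%N & walk e l y x.
  apply: dist_le_forward.
  have -> : (pos y + (n.*2 - (pos y - pos x)) = pos x + n.*2)%N by lia.
  by rewrite modnDr modn_small // pos_lt.
by exists l; [lia|exact: walk_sym].
Qed.

Lemma swap_edge x y : e (swap x) (swap y) = e x y.
Proof.
have swap_inj := inv_inj (@swapK n).
elim/vertexP: x => [s i|k].
  rewrite swap_rim (chain_rim e_chain).
  rewrite (chain_rim e_chain) !addNb -!swap_rim -swap_mid.
  exact: (mem_map swap_inj [:: _; _; _]).
rewrite (chain_vw e_chain) (chain_vw e_chain).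
by rewrite -[RHS](mem_map swap_inj) !inE orbC.
Qed.

Lemma near_swap x : swap x = x \/ exists2 y, e x y & swap y = y \/ y = swap x.
Proof.
elim/vertexP: x => [s i|k]; last by left.
right; exists (mid s i); first exact: edge_rim_mid.
by rewrite swap_rim /mid; case: ifP; [left|right].
Qed.

(** * Effective resistances of a chain *)

Section Resistance.
Variable R : realType.

(** [quad N t / N] is the resistance at distance t in a cycle of N unit edges; two parallel rims
    halve it, whence the divisor [2 * N] later. *)
Definition quad (N t : nat) : R := t%:R * (N%:R - t%:R).
Definition green (p : nat) (x : vertex n) : R := quad n.*2 (absdiff p (pos x)).
Definition rim_sum (v : vertex n -> R) (i : 'I_n.*2) : R :=
  v (rim false i) + v (rim true i).

Lemma absdiff_le p q : (p <= q)%N -> (absdiff p q)%:R = q%:R - p%:R :> R.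
Proof. by move=> pq; rewrite -natrB //; congr _%:R; rewrite /absdiff; lia. Qed.

Lemma absdiff_ge p q : (q <= p)%N -> (absdiff p q)%:R = p%:R - q%:R :> R.
Proof. by move=> qp; rewrite -natrB //; congr _%:R; rewrite /absdiff; lia. Qed.

(** t(N - t) has second difference -2 and is symmetric under t -> N - t, so the wrap is invisible;
    at [p] both cyclic neighbours have value N - 1. The [mid] neighbour has the same position and
    contributes 0. *)
Lemma lap_green_rim (p : 'I_n.*2) s i :
  lap e (green p) (rim s i) = 2 - 2 * n.*2%:R * (i == p)%:R.
Proof.
rewrite /lap sum_rim_nbrs /next /prev /green !pos_rim pos_mid val_ordS val_ord_pred.
rewrite /quad -val_eqE /=.
have ltp := ltn_ord p; have lti := ltn_ord i; have : (n.*2.-1.+1 = n.*2)%N by lia.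
have : (1 < n.*2)%N by lia.
move: (n.*2) (n.*2.-1) (nat_of_ord i) (nat_of_ord p) ltp lti => N N' a b ltb lta N1 NE.
have NR : N%:R = N'%:R + 1 :> R by rewrite -NE -natr1.
(* [a] and [b] are the positions of [i] and [p]; the inner cases isolate the ends of the index
   range, where a neighbour wraps. *)
have [ab|ba|eab] := ltngtP a b.
- rewrite /= mulr0 subr0 (ltn_eqF (leq_ltn_trans ab ltb)) (absdiff_ge ab) (absdiff_ge (ltnW ab)).
  case: (a =P 0%N) => [->|a0].
    by rewrite absdiff_le -?natr1; [rewrite NR; ring|lia].
  have aE : a%:R = a.-1%:R + 1 :> R by rewrite natr1 prednK //; lia.
  by rewrite absdiff_ge -?natr1 ?aE; [ring|lia].
- rewrite /= mulr0 subr0; have -> : (a == 0%N) = false by lia.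
  have aE : a%:R = a.-1%:R + 1 :> R by rewrite natr1 prednK //; lia.
  have ba1 : (b <= a.-1)%N by lia.
  rewrite (absdiff_le ba1) (absdiff_le (ltnW ba)).
  case: (a.+1 =P N) => [<-|aN].
    by rewrite absdiff_ge // -natr1 aE; ring.
  by rewrite absdiff_le -?natr1 ?aE; [ring|lia].
- rewrite -{}eab /= mulr1 in ltb *; rewrite (absdiff_le (leqnn a)).
  case: (a =P 0%N) => [->|a0].
    have -> : (1%N == N) = false by lia.
    by rewrite !absdiff_le // NR; ring.
  have aE : a%:R = a.-1%:R + 1 :> R by rewrite natr1 prednK //; lia.
  rewrite (absdiff_ge (leq_pred a)).
  case: (a.+1 =P N) => [<-|aN]; first by rewrite absdiff_ge // -natr1 aE; ring.
  by rewrite absdiff_le // -natr1 aE; ring.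
Qed.

Lemma lap_green_vw p k : lap e (green p) (vw k) = 0.
Proof.
by rewrite /lap sum_vw_nbrs /green !pos_rim /= !subrr addr0.
Qed.

(** Moving [lap] onto [green p] isolates the rim sum at [p], up to a term independent of [p]. *)
Lemma pair_green v (p : 'I_n.*2) :
  \sum_x lap e v x * green p x =
  2 * (\sum_i rim_sum v i) - 2 * n.*2%:R * rim_sum v p.
Proof.
rewrite lap_sym // sum_vertex [X in _ + X]big1 => [|k _]; last first.
  by rewrite lap_green_vw mulr0.
rewrite addr0 (eq_bigr (fun i => 2 * rim_sum v i -
  2 * n.*2%:R * ((i == p)%:R * rim_sum v i))); last first.
  by move=> i _; rewrite !lap_green_rim /rim_sum; ring.
rewrite sumrB -!mulr_sumr; congr (_ - _ * _).
rewrite (bigD1 p) // eqxx mul1r big1 => [|i /negPf ->]; last by rewrite mul0r.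
exact: addr0.
Qed.

(** A rim vertex is off the mean by half the antisymmetric part, at most M; at [w] the deviation is
    half of [lap e v]. *)
Lemma near_rim_mean v M x : 0 <= M -> (forall y, `|lap e v y| <= M) ->
  `|v x - rim_sum v (Ordinal (pos_lt x)) / 2| <= M.
Proof.
move=> M0 lapM; have asym := antisym_part_le swap_edge (@swapK n) near_swap M0 lapM.
elim/vertexP: x => [s i|k].
  have -> : Ordinal (pos_lt (rim s i)) = i by apply: val_inj; rewrite /= pos_rim.
  have := asym (rim false i); have := asym (rim true i); rewrite !swap_rim /rim_sum.
  by rewrite ler_norml => ? ?; case: s; apply/andP; split; lra.
have -> : Ordinal (pos_lt (vw k)) = odd_ord k by apply: val_inj.
have := lapM (vw k); rewrite /lap sum_vw_nbrs /rim_sum !ler_norml.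
by move=> /andP[? ?]; apply/andP; split; lra.
Qed.

Lemma unit_current_chain x y : exists v : vertex n -> R, unit_current e x y v.
Proof.
have N_neq0 : (n.*2)%:R != 0 :> R by rewrite pnatr_eq0; lia.
apply: unit_current_exists => // h h0.
have hE z : h z = rim_sum h (Ordinal (pos_lt z)) / 2.
  apply/eqP; rewrite -subr_eq0 -normr_le0; apply: near_rim_mean => // t.
  by rewrite h0 normr0.
(* For harmonic [h] the pairing is 0, so all rim sums agree; by [hE], [h] is then constant. *)
have rim_const p : 2 * n.*2%:R * rim_sum h p = 2 * \sum_i rim_sum h i.
  apply/esym/eqP; rewrite -subr_eq0 -pair_green big1 // => z _.
  by rewrite h0 mul0r.
move=> z t; rewrite (hE z) (hE t); congr (_ / _).
by apply: (@mulfI _ (2 * n.*2%:R)); rewrite ?mulf_neq0 // !rim_const.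
Qed.

Lemma quad_eff_res x y :
  `|eff_res e R x y - quad n.*2 (absdiff (pos x) (pos y)) / (2 * n.*2%:R)| <= 2.
Proof.
have N_neq0 : (n.*2)%:R != 0 :> R by rewrite pnatr_eq0; lia.
have [v vxy ->] := eff_resP (unit_current_chain x y).
have lapM z : `|lap e v z| <= 1.
  rewrite [lap e v z]vxy; case: eqP; case: eqP;
    by rewrite ?subrr ?subr0 ?sub0r ?normrN ?normr1 ?normr0.
have pairE (p : 'I_n.*2) : \sum_z lap e v z * green p z = green p x - green p y.
  have pick t : \sum_z (z == t)%:R * green p z = green p t.
    rewrite (bigD1 t) //= eqxx mul1r big1 ?addr0 // => z /negPf ->.
    by rewrite mul0r.
  by under eq_bigr do rewrite [lap e v _]vxy mulrBl; rewrite sumrB !pick.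
have := near_rim_mean x ler01 lapM; have := near_rim_mean y ler01 lapM.
have := pairE (Ordinal (pos_lt x)); have := pairE (Ordinal (pos_lt y)).
rewrite !pair_green /green /=.
have -> : absdiff (pos y) (pos x) = absdiff (pos x) (pos y) by rewrite /absdiff; lia.
have quad0 t : quad n.*2 (absdiff t t) = 0 by rewrite /absdiff subnn /quad mul0r.
rewrite !quad0.
set q := quad _ _; set a := rim_sum _ _; set b := rim_sum _ _ => Ea Eb.
(* Subtracting the two pairings cancels the total of the rim sums, so [q] gives the exact difference
   of rim means; each endpoint then adds an error of at most 1. *)
have -> : q / (2 * n.*2%:R) = (b - a) / 2.
  have -> : q = n.*2%:R * (b - a) by lra.
  by field.
rewrite !ler_norml => /andP[? ?] /andP[? ?]; apply/andP; split; lra.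
Qed.

End Resistance.
End Chain.

(** * Asymptotics of the indices *)

Section Sums.
Variable R : realType.

Lemma sum_ord_double (V : nmodType) (F : nat -> V) n :
  \sum_(i < n.*2) F i = \sum_(k < n) (F k.*2 + F k.*2.+1).
Proof.
elim: n => [|n IHn]; first by rewrite !big_ord0.
by rewrite doubleS !big_ord_recr /= IHn addrA.
Qed.

(** Rotation invariance: the [q] from [p] on give t < N - p, and reflecting the others by t -> N - t
    fills the rest. *)
Lemma sum_absdiff (V : nmodType) (f : nat -> V) N p : (p < N)%N ->
    (forall t, (t <= N)%N -> f (N - t)%N = f t) ->
  \sum_(q < N) f (absdiff p q) = \sum_(t < N) f t.
Proof.
move=> ltp fN; rewrite -(big_mkord xpredT (fun q => f (absdiff p q))).
rewrite -(big_mkord xpredT f) (big_cat_nat (n := p)) //=; last exact: ltnW.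
rewrite [RHS](big_cat_nat (n := (N - p)%N)) //=; last exact: leq_subr.
rewrite addrC; congr (_ + _).
  rewrite -{1}[p]add0n big_addn; apply: eq_big_nat => t _.
  by congr f; rewrite /absdiff; lia.
have := big_addn 0 N (N - p) xpredT f; rewrite add0n => ->.
rewrite subKn; last exact: ltnW.
apply: eq_big_nat => q /andP[_ ltq]; rewrite -fN; last by rewrite /absdiff; lia.
by congr f; rewrite /absdiff; lia.
Qed.

Lemma sum_minn n :
  \sum_(t < n.*2) (minn t (n.*2 - t))%:R = n%:R ^+ 2 :> R.
Proof.
rewrite -natrX -natr_sum; congr _%:R.
(* The terms at t and n + t are t and n - t, with sum n. *)
rewrite -addnn big_split_ord /= -big_split /= (eq_bigr (fun=> n)) => [|i _]; last first.
  by have := ltn_ord i; lia.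
by rewrite sum_nat_const card_ord mulnn.
Qed.

Lemma sum_quad N :
  \sum_(t < N) quad R N t = N%:R * (N%:R ^+ 2 - 1) / 6.
Proof.
(* The summation bound must vary while the N inside [quad] stays fixed. *)
have part m : \sum_(t < m) quad R N t =
    N%:R * (m%:R * (m%:R - 1) / 2) - m%:R * (m%:R - 1) * (2 * m%:R - 1) / 6.
  elim: m => [|m IHm]; first by rewrite big_ord0 !mul0r mulr0 subrr.
  by rewrite big_ord_recr /= IHm /quad -natr1; field.
by rewrite part; field.
Qed.

(** * Degree-weighted double sums *)

Section Weighted.
Variables (n : nat) (tw : bool) (e : rel (vertex n)).
Hypothesis n_gt1 : (1 < n)%N.
Hypothesis e_chain : pent_chain tw e.

(** Positions 2k and 2k+1 carry total degrees 6 and 8, that is 7 each plus a correction of one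
    difference of [F]. *)
Lemma sum_deg_pos (F : nat -> R) :
  \sum_x (deg e x)%:R * F (pos x) =
  7 * \sum_(i < n.*2) F i + \sum_(k < n) (F k.*2.+1 - F k.*2).
Proof.
rewrite sum_vertex (eq_bigr (fun i : 'I_n.*2 => 6 * F i)) => [|i _]; last first.
  by rewrite !(deg_rim n_gt1 e_chain) !pos_rim; ring.
rewrite [X in _ + X](eq_bigr (fun k : 'I_n => 2 * F k.*2.+1)) => [|k _]; last first.
  by rewrite (deg_vw e_chain).
rewrite -!mulr_sumr !sum_ord_double !mulr_sumr -!big_split /=.
by apply: eq_bigr => k _; ring.
Qed.

Lemma sum_deg : \sum_x (deg e x)%:R = 14 * n%:R :> R.
Proof.
rewrite (eq_bigr (fun x => (deg e x)%:R * 1)) => [|x _]; last by rewrite mulr1.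
rewrite (sum_deg_pos (fun=> 1)) [X in _ + X]big1 => [|k _]; last by rewrite subrr.
by rewrite addr0 sumr_const card_ord -mul2n natrM; ring.
Qed.

Lemma weighted_sum_approx (A : vertex n -> vertex n -> R) (f : nat -> R) C :
    (forall t, (t < n.*2)%N -> `|f t.+1 - f t| <= 1) ->
    (forall t, (t <= n.*2)%N -> f (n.*2 - t)%N = f t) ->
    (forall x y, `|A x y - f (absdiff (pos x) (pos y))| <= C) ->
  `|\sum_x \sum_y (deg e x)%:R * (deg e y)%:R * A x y
    - 98 * n%:R * \sum_(t < n.*2) f t| <= (196 * C + 14) * n%:R ^+ 2.
Proof.
move=> f_lip f_sym A_f; set S := \sum_(t < _) f t.
(* Replacing [A] by [f] costs C times the total degree 14n; the n parity corrections cost at most 1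
   each. Weighting the rows by degree multiplies by 14n again. *)
have row x : `|\sum_y (deg e y)%:R * A x y - 7 * S| <= (14 * C + 1) * n%:R.
  pose F q := f (absdiff (pos x) q).
  have -> : \sum_y (deg e y)%:R * A x y - 7 * S =
      \sum_y (deg e y)%:R * (A x y - F (pos y))
      + \sum_(k < n) (F k.*2.+1 - F k.*2).
    have -> : S = \sum_(i < n.*2) F i by rewrite /F sum_absdiff // pos_lt.
    under [in RHS]eq_bigr do rewrite mulrBr.
    by rewrite sumrB sum_deg_pos; ring.
  apply: le_trans (ler_normD _ _) _; rewrite mulrDl mul1r lerD //.
    apply: le_trans (ler_norm_sum _ _ _) _.
    rewrite mulrAC -sum_deg mulr_suml ler_sum // => y _.
    by rewrite normrM normr_nat ler_wpM2l.
  apply: le_trans (ler_norm_sum _ _ _) _.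
  rewrite -[leRHS](_ : \sum_(k < n) 1 = _); last by rewrite sumr_const card_ord.
  apply: ler_sum => k _; rewrite /F; have lt_k := ltn_ord k; have ltx := pos_lt x.
  have [le_k|lt_xk] := leqP (pos x) k.*2.
    have -> : absdiff (pos x) k.*2.+1 = (absdiff (pos x) k.*2).+1.
      by rewrite /absdiff; lia.
    by apply: f_lip; rewrite /absdiff; lia.
  have -> : absdiff (pos x) k.*2 = (absdiff (pos x) k.*2.+1).+1.
    by rewrite /absdiff; lia.
  by rewrite distrC; apply: f_lip; rewrite /absdiff; lia.
have -> : \sum_x \sum_y (deg e x)%:R * (deg e y)%:R * A x y - 98 * n%:R * S =
    \sum_x (deg e x)%:R * (\sum_y (deg e y)%:R * A x y - 7 * S).
  under [in RHS]eq_bigr do rewrite mulrBr.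
  rewrite sumrB -mulr_suml sum_deg; congr (_ - _); last by ring.
  by apply: eq_bigr => x _; rewrite mulr_sumr; apply: eq_bigr => y _; rewrite mulrA.
apply: le_trans (ler_norm_sum _ _ _) _.
have -> : (196 * C + 14) * n%:R ^+ 2 = 14 * n%:R * ((14 * C + 1) * n%:R) by ring.
rewrite -sum_deg mulr_suml ler_sum // => x _.
by rewrite normrM normr_nat ler_wpM2l.
Qed.

Lemma Gut_approx : `|Gut e R - 49 * n%:R ^+ 3| <= 399 * n%:R ^+ 2.
Proof.
have := @weighted_sum_approx (fun x y => (dist e x y)%:R)
  (fun t => (minn t (n.*2 - t))%:R) 4.
rewrite sum_minn /Gut; set s := \sum_x _ => approx.
have {approx} : `|s - 98 * n%:R * n%:R ^+ 2| <= (196 * 4 + 14) * n%:R ^+ 2.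
  (* Here C = 4, and halving 196 * 4 + 14 gives 399. *)
  apply: approx => [t ltt|t ltt|x y].
  - have [h1 h2] : (minn t.+1 (n.*2 - t.+1) <= (minn t (n.*2 - t)).+1)%N /\
        (minn t (n.*2 - t) <= (minn t.+1 (n.*2 - t.+1)).+1)%N by lia.
    move: h1 h2; rewrite -2!(ler_nat R) -!natr1 ler_norml => h1 h2.
    by apply/andP; split; lra.
  - by congr _%:R; lia.
  - have := cycdist_le_dist n_gt1 e_chain x y; have := dist_le_cycdist n_gt1 e_chain x y.
    rewrite /cycdist; set c := minn _ _ => d1 d2.
    rewrite ger0_norm ?subr_ge0 ?ler_nat // lerBlDl.
    by rewrite -[4]/(4%:R) -natrD ler_nat.
rewrite !ler_norml => /andP[? ?]; apply/andP; split; lra.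
Qed.

Lemma Kfstar_approx : `|Kfstar e R - 49 / 3 * n%:R ^+ 3| <= 208 * n%:R ^+ 2.
Proof.
have n_ge1 : 1 <= n%:R :> R by rewrite ler1n ltnW.
have NE : n.*2%:R = 2 * n%:R :> R by rewrite -mul2n natrM.
have := @weighted_sum_approx (eff_res e R)
  (fun t => quad R n.*2 t / (2 * n.*2%:R)) 2.
rewrite -mulr_suml sum_quad /Kfstar; set s := \sum_x _ => approx.
have {approx} : `|s - 98 * n%:R * (n.*2%:R * (n.*2%:R ^+ 2 - 1) / 6 / (2 * n.*2%:R))|
    <= (196 * 2 + 14) * n%:R ^+ 2.
  (* Here C = 2, giving 203 after halving; the lower-order term 49n/12 of the main sum is absorbed
     by the remaining 5, as n <= n^2. *)
  apply: approx => [t ltt|t ltt|x y].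
  - have tN : t%:R + 1 <= n.*2%:R :> R by rewrite natr1 ler_nat.
    have t0 : 0 <= t%:R :> R by [].
    rewrite -mulrBl normrM [X in _ * X]ger0_norm; last by rewrite invr_ge0; lra.
    rewrite ler_pdivrMr; last by lra.
    rewrite /quad -natr1 ler_norml; apply/andP; split; lra.
  - by congr (_ / _); rewrite /quad natrB //; ring.
  - exact: (quad_eff_res n_gt1 e_chain).
have -> : n.*2%:R * (n.*2%:R ^+ 2 - 1) / 6 / (2 * n.*2%:R) = (4 * n%:R ^+ 2 - 1) / 12 :> R.
  by rewrite NE; field; lra.
have : n%:R <= n%:R ^+ 2 :> R by rewrite expr2 ler_peMr.
rewrite !ler_norml => ? /andP[? ?]; apply/andP; split; lra.
Qed.

End Weighted.

(** * Passage to the limit *)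

Lemma cvg_cubic_ratio (u v : nat -> R) (a b C D : R) : b != 0 ->
    (\forall n \near \oo, `|u n - a * n%:R ^+ 3| <= C * n%:R ^+ 2) ->
    (\forall n \near \oo, `|v n - b * n%:R ^+ 3| <= D * n%:R ^+ 2) ->
  (fun n => u n / v n) @ \oo --> a / b.
Proof.
have scaled (w : nat -> R) c E :
    (\forall n \near \oo, `|w n - c * n%:R ^+ 3| <= E * n%:R ^+ 2) ->
    (fun n => w n / n%:R ^+ 3) @ \oo --> c.
  move=> wc; apply/cvgrPdist_le => eps eps0; near=> n.
  have n0 : 0 < n%:R :> R by rewrite ltr0n; near: n; exact: nbhs_infty_gt.
  have n30 : 0 < n%:R ^+ 3 :> R by rewrite exprn_gt0.
  have -> : c - w n / n%:R ^+ 3 = - ((w n - c * n%:R ^+ 3) / n%:R ^+ 3).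
    by field; rewrite gt_eqF.
  rewrite normrN normf_div (gtr0_norm n30) ler_pdivrMr //.
  apply: (@le_trans _ _ (E * n%:R ^+ 2)); first by near: n.
  (* It remains to have E <= eps * n, which holds for large n. *)
  have -> : eps * n%:R ^+ 3 = eps * n%:R * n%:R ^+ 2 by ring.
  rewrite ler_wpM2r ?exprn_ge0 ?(ltW n0) // mulrC -ler_pdivrMr //.
  by near: n; exact: nbhs_infty_ger.
move=> b0 /scaled ua /scaled vb.
have : (fun n => (u n / n%:R ^+ 3) / (v n / n%:R ^+ 3)) @ \oo --> a / b.
  by apply: cvgM => //; apply: cvgV.
apply: cvg_trans; apply: near_eq_cvg; near=> n.
have n0 : n%:R != 0 :> R by rewrite pnatr_eq0 -lt0n; near: n; exact: nbhs_infty_gt.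
by rewrite invf_div mulrA divfK // expf_neq0.
Unshelve. all: by end_near.
Qed.

Lemma cvg_Gut_Kfstar tw (e : forall n, rel (vertex n)) :
    (forall n, (1 < n)%N -> pent_chain tw (e n)) ->
  (fun n => Gut (e n) R / Kfstar (e n) R) @ \oo --> (3 : R).
Proof.
move=> e_chain; have -> : 3 = 49 / (49 / 3) :> R by field.
apply: (@cvg_cubic_ratio _ _ _ _ 399 208).
- by rewrite mulf_neq0 ?invr_neq0 ?pnatr_eq0.
- near=> n; have n_gt1 : (1 < n)%N by near: n; exact: nbhs_infty_gt.
  exact: Gut_approx (e_chain n n_gt1).
- near=> n; have n_gt1 : (1 < n)%N by near: n; exact: nbhs_infty_gt.
  exact: Kfstar_approx (e_chain n n_gt1).
Unshelve. all: by end_near.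
Qed.

End Sums.

Theorem theorem12 (R : realType) :
  (fun n : nat => Gut (pent_cylinder n) R / Kfstar (pent_cylinder n) R)
     @ \oo --> (3 : R)
  /\ (fun n : nat => Gut (pent_moebius n) R / Kfstar (pent_moebius n) R)
     @ \oo --> (3 : R).
Proof.
split; apply: cvg_Gut_Kfstar.
- exact: cylinder_chain.
- exact: moebius_chain.
Qed.
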